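(* Let $s$ and $p$ be positive integers, and write $s=kp+r$ with $k\ge 0$ an integer and $0\le r<p$. Then the number of $(s,s+1)$-core partitions $\lambda$ all of whose parts are multiples of $p$ equals the Raney number \[R_{p+1,r+1}(k)=\frac{r+1}{k(p+1)+r+1}\binom{k(p+1)+r+1}{k}.\] Equivalently, this number equals $\frac{s+1-p\lfloor s/p\rfloor}{s+1}\binom{s+\lfloor s/p\rfloor}{s}$.
   Context: A partition $\lambda=(\lambda_1,\dots,\lambda_m)$ is a finite nonincreasing sequence of positive integers (the empty partition is included). In its Young diagram (left- and top-justified rows of $\lambda_i$ boxes), the hook length of a box is the number of boxes consisting of the box itself, the boxes directly to its right, and the boxes directly below it. For a positive integer $t$, $\lambda$ is a $t$-core if no box has hook length divisible by $t$; $\lambda$ is an $(s,t)$-core if it is both an $s$-core and a $t$-core. The Raney numbers are $R_{p,r}(k)=\frac{r}{kp+r}\binom{kp+r}{k}$. *)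

(* Defs.v *)
From mathcomp Require Import all_boot all_order all_algebra.
Set Implicit Arguments. Unset Strict Implicit. Unset Printing Implicit Defensive.
Import GRing.Theory Num.Theory.

Definition is_partition (la : seq nat) : bool :=
  sorted geq la && all (fun x => 0 < x) la.

Definition row (la : seq nat) (i : nat) : nat := nth 0 la i.

Definition col (la : seq nat) (j : nat) : nat := count (fun x => j < x) la.

(* Hook length of box (i,j): the box itself, the boxes to its right,
   and the boxes below it. *)
Definition hook (la : seq nat) (i j : nat) : nat :=
  1 + (row la i - j.+1) + (col la j - i.+1).

Definition is_box (la : seq nat) (i j : nat) : bool :=
  (i < size la) && (j < row la i).

Definition is_core (t : nat) (la : seq nat) : bool :=
  [forall i : 'I_(size la), forall j : 'I_(row la i), ~~ (t %| hook la i j)].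

Definition raney (p r k : nat) : rat :=
  (r%:R / (k * p + r)%:R * ('C(k * p + r, k))%:R)%R.

(* Main.v *)
(** Reading the boundary of a partition as a boolean word whose [true] letters
    sit at the hook lengths of the first row, every hook length is the distance
    from a [false] to a later [true].  So the partition is a t-core iff the set
    of [true] positions is closed under subtracting t (as long as one stays in
    the natural numbers), and its parts are multiples of p iff the maximal runs
    of [true] have length divisible by p.
    Write positions as q s + c with c < s.  Closure under s says that column c
    contains exactly the q below some height h(c), and closure under s + 1 then
    says h(0) = 0 and h(c+1) <= h(c) + 1.  Since column 0 is empty, runs never
    wrap around, so the condition on runs is on each level set {c | q < h(c)}.
    Cutting h at its first return to 0, h = 0 :: (x + 1) ++ y, the condition
    becomes: p divides the length of x, and x and y satisfy it again.  Hence the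
    counts satisfy f(s+1) = sum_m f(m p) f(s - m p), i.e. the generating series
    of k |-> f(k p + r) is T^(r+1) with T = 1 + z T^(p+1), as for Raney numbers. *)

From mathcomp Require Import all_boot all_order all_algebra.
From mathcomp Require Import zify.
Require Import Defs.
Import GRing.Theory Num.Theory.
Set Implicit Arguments. Unset Strict Implicit. Unset Printing Implicit Defensive.

(** * Boundary words and hook lengths *)

(* Each [false] contributes the number of later [true]s as a part; empty parts
   are dropped, so trailing [false]s and leading [true]s are irrelevant. *)
Fixpoint parts_of (w : seq bool) : seq nat :=
  if w is b :: w' then
    if b || (count id w' == 0) then parts_of w' else count id w' :: parts_of w'
  else [::].

Lemma parts_of_le w : all (fun x => x <= count id w) (parts_of w).
Proof.
elim: w => //= b w IH; case: ifP => _ /=; last rewrite leq_addl /=;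
  apply: sub_all IH => x /leq_trans-> //; exact: leq_addl.
Qed.

Lemma parts_of_partition w : is_partition (parts_of w).
Proof.
rewrite /is_partition; elim: w => //= b w /andP[IHs IHp].
case: ifP => [_|/norP[_ n0]]; first by rewrite IHs.
by rewrite /= lt0n n0 IHp path_min_sorted ?IHs ?parts_of_le.
Qed.

Lemma col_large w j : count id w <= j -> col (parts_of w) j = 0.
Proof.
move=> le_wj; apply/eqP; rewrite -leqn0 leqNgt -has_count -all_predC.
by apply: sub_all (parts_of_le w) => x /= le_xw; rewrite -leqNgt (leq_trans le_xw).
Qed.

(* [n - j + col la j] is the hook length of box [(0, j)] in [n :: la]. *)
Lemma first_row_hooks (P : nat -> Prop) w :
  (forall j, j < count id w -> P (count id w - j + col (parts_of w) j)) <->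
  (forall b, nth false w b -> P b.+1).
Proof.
elim: w P => [|b w IH] P /=; first by split=> // _ b; rewrite nth_nil.
(* A leading [true] adds a column with hook length 1, a leading [false] adds a box to every column;
   either way the hook lengths already present grow by one. *)
case: b => /=.
- rewrite add1n; split=> [H [_|b wb]|H j].
  + by have := H (count id w) (ltnSn _); rewrite subSnn col_large.
  + apply: (iffLR (IH (fun x => P x.+1))) wb => j lt_j.
    by have := H j (ltnW lt_j); rewrite subSn ?addSn // ltnW.
  + rewrite ltnS leq_eqVlt => /orP[/eqP->|lt_j].
      by rewrite subSnn col_large //; exact: (H 0).
    rewrite subSn ?addSn 1?ltnW //.
    by apply: (iffRL (IH (fun x => P x.+1))) lt_j => b wb; exact: (H b.+1).
- rewrite add0n; have [n0|n0] := eqVneq (count id w) 0.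
    rewrite n0; split=> // _ [//|b] /= wb; suff: 0 < count id w by rewrite n0.
    rewrite -has_count; apply/hasP; exists true => //; rewrite -wb mem_nth //.
    by case: ltnP wb => // /(nth_default false)->.
  split=> [H [//|b] wb|H j lt_j].
  + apply: (iffLR (IH (fun x => P x.+1))) wb => j lt_j.
    by have := H j lt_j; rewrite /col /= lt_j addnCA add1n.
  + rewrite /col /= lt_j addnCA add1n.
    by apply: (iffRL (IH (fun x => P x.+1))) lt_j => b wb; exact: (H b.+1).
Qed.

Lemma is_coreP t la :
  reflect (forall i j, i < size la -> j < row la i -> ~~ (t %| hook la i j))
          (is_core t la).
Proof.
apply: (iffP forallP) => [H i j lt_i lt_j|H i].
  exact: (forallP (H (Ordinal lt_i)) (Ordinal lt_j)).
by apply/forallP => j; apply: H.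
Qed.

Lemma is_core_cons t n la : all (fun x => x <= n) la ->
  is_core t (n :: la) <->
  (forall j, j < n -> ~~ (t %| n - j + col la j)) /\ is_core t la.
Proof.
move=> /allP le_n.
have hook0 j : j < n -> hook (n :: la) 0 j = n - j + col la j.
  by move=> lt_j; rewrite /hook /col /row /= lt_j; lia.
have hookS i j : i < size la -> j < row la i ->
    hook (n :: la) i.+1 j = hook la i j.
  move=> lt_i lt_j; rewrite /hook /col /row /=.
  by rewrite (leq_trans lt_j) ?le_n ?mem_nth // add1n subSS.
split=> [/is_coreP H|[H0 /is_coreP HS]].
  split=> [j lt_j|]; first by rewrite -hook0 //; exact: H.
  by apply/is_coreP => i j lt_i lt_j; rewrite -hookS //; exact: H.
by apply/is_coreP => -[|i] j lt_i lt_j; rewrite ?hook0 ?hookS //; [exact: H0|exact: HS].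
Qed.

(** The row of a [false] has as hook lengths the distances to the later [true]s, by
    [first_row_hooks]. *)
Lemma is_core_parts_of t w :
  is_core t (parts_of w) <->
  (forall z d, ~~ nth false w z -> nth false w (z + d.+1) -> ~~ (t %| d.+1)).
Proof.
elim: w => [|b w IH] /=.
  by split=> [_ z d _|_]; [rewrite nth_nil | apply/is_coreP].
(* [Q] is the condition on the row of the letter [b], trivial if there is no such row. *)
have tailP (Q : Prop) :
    (Q <-> (b \/ forall d, nth false w d -> ~~ (t %| d.+1))) ->
    (Q /\ is_core t (parts_of w)) <->
    (forall z d, ~~ nth false (b :: w) z -> nth false (b :: w) (z + d.+1) ->
       ~~ (t %| d.+1)).
  move=> HQ; rewrite HQ IH; split=> [[H0 HS] [|z] d|H].
  - by case: H0 => [-> //|H0 _]; exact: H0.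
  - exact: HS.
  split; last by move=> z d; exact: (H z.+1 d).
  by case: b {HQ IH} H => H; [left | right=> d; exact: (H 0)].
case: ifP => [|/norP[/negbTE b0 n0]].
  move=> bn0; apply: iff_trans (tailP True _); first by split=> [|[]].
  split=> // _; case: b bn0 {tailP} => [_|/= /eqP n0]; first by left.
  by right; apply/(first_row_hooks (fun x => ~~ (t %| x))); rewrite n0.
rewrite is_core_cons ?parts_of_le //; apply: tailP.
rewrite (first_row_hooks (fun x => ~~ (t %| x))) b0.
by split=> [H|[//|H]]; [right|].
Qed.

(** Excluding the distance [t] excludes its multiples: subtracting [t] repeatedly from a [true]
    position meets only [true]. *)
Lemma is_core_parts_ofE t w : 0 < t ->
  is_core t (parts_of w) <-> (forall b, nth false w (b + t) -> nth false w b).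
Proof.
move=> t0; rewrite is_core_parts_of; split=> [H b wb|H z d wz].
  apply/negPn/negP => wNb.
  by have := H b t.-1 wNb; rewrite prednK // dvdnn => /(_ wb).
move=> wd; apply/negP => /dvdnP[k dE]; move: wd wz; rewrite dE.
elim: k {dE} => [|k IH]; first by rewrite addn0 => ->.
by rewrite mulSn addnCA addnC => /H; exact: IH.
Qed.

(** * Passing between words and partitions *)

Fixpoint word_of (la : seq nat) : seq bool :=
  if la is x :: la' then false :: nseq (x - head 0 la') true ++ word_of la'
  else [::].

Lemma parts_of_cat_true k w : parts_of (nseq k true ++ w) = parts_of w.
Proof. by elim: k. Qed.

Lemma word_ofK la : is_partition la -> parts_of (word_of la) = la.
Proof.
rewrite /is_partition => /andP[].
have cntE u : sorted geq u -> count id (word_of u) = head 0 u.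
  elim: u => //= x u IH xu; rewrite add0n count_cat count_nseq /= mul1n.
  rewrite IH ?(path_sorted xu) // subnK //.
  by case: u xu {IH} => //= y u /andP[].
elim: la => //= x la IH xla /andP[x0 la0].
have := cntE (x :: la) xla; rewrite /= add0n => ->.
by rewrite (gtn_eqF x0) parts_of_cat_true IH ?(path_sorted xla).
Qed.

Lemma parts_of_cat_false w k : parts_of (w ++ nseq k false) = parts_of w.
Proof.
elim: w => [|b w IH] /=; last by rewrite IH count_cat count_nseq addn0.
by elim: k => //= k ->; rewrite count_nseq.
Qed.

Lemma parts_of_eq_nth w w' :
  nth false w =1 nth false w' -> parts_of w = parts_of w'.
Proof.
move=> eq_ww'; rewrite -(parts_of_cat_false w (size w')) -(parts_of_cat_false w' (size w)).
congr parts_of; apply: (@eq_from_nth _ false) => [|i _].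
  by rewrite !size_cat !size_nseq addnC.
have nthE (u : seq bool) k : nth false (u ++ nseq k false) i = nth false u i.
  by rewrite nth_cat; case: ltnP => // le_i; rewrite nth_nseq if_same nth_default.
by rewrite !nthE.
Qed.

(** Length and number of [true]s fix the trailing [false]s and leading [true]s, which [parts_of]
    forgets. *)
Lemma parts_of_inj w w' : size w = size w' -> count id w = count id w' ->
  parts_of w = parts_of w' -> w = w'.
Proof.
(* The first part on the right is [count id u'], larger than every part of [u]. *)
have noTF u u' : count id u < count id u' -> parts_of u <> parts_of (false :: u').
  move=> lt_u /=; case: eqP => [n0|_ Epu]; first by rewrite n0 in lt_u.
  by have := parts_of_le u; rewrite Epu /= leqNgt lt_u.
elim: w w' => [|b w IH] [|b' w'] // [sz]; case: b; case: b' => cnt Ep.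
- by move: cnt => /= [cnt]; rewrite (IH w').
- by case: (@noTF w w') => //; move: cnt => /=; lia.
- by case: (@noTF w' w) => //; move: cnt => /=; lia.
move: cnt Ep => /= /[!add0n] cnt; rewrite cnt.
have all0 (u : seq bool) : count id u = 0 -> u = nseq (size u) false.
  by elim: u => //= -[] //= u IHu /IHu {1}->.
case: eqP => [n0 _|_ [Ep]]; last by rewrite (IH w').
by congr (_ :: _); rewrite (all0 w') // -sz; apply: all0; rewrite cnt.
Qed.

(** * Divisibility of the parts *)

(** Counts to the right of each [false] replace run lengths, which are their differences; a leading
    run is left free. *)
Fixpoint runs_dvd (p : nat) (w : seq bool) : bool :=
  if w is b :: w' then (b || (p %| count id w')) && runs_dvd p w' else true.

Lemma all_dvd_parts_of p w : all (fun x => p %| x) (parts_of w) = runs_dvd p w.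
Proof.
by elim: w => //= -[] //= w <-; case: eqP => //= ->; rewrite dvdn0.
Qed.

Lemma runs_dvd_cat p w1 w2 : p %| count id w2 ->
  runs_dvd p (w1 ++ w2) = runs_dvd p w1 && runs_dvd p w2.
Proof.
move=> p_w2; elim: w1 => //= b w1 ->.
by rewrite count_cat dvdn_addl // andbA.
Qed.

Lemma runs_dvd_catr p w1 w2 : runs_dvd p (w1 ++ w2) -> runs_dvd p w2.
Proof. by elim: w1 => //= b w1 IH /andP[_ /IH]. Qed.

Lemma runs_dvd_nseq p k b : runs_dvd p (nseq k b).
Proof. by elim: k => //= k ->; case: b => //; rewrite count_nseq mul0n dvdn0. Qed.

Lemma runs_dvd_count p w : ~~ head false w -> runs_dvd p w -> p %| count id w.
Proof. by case: w => [|[] w] //= _ /andP[]. Qed.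

(** * Height sequences and the first return to 0 *)

Definition heights (h : seq nat) : bool :=
  (head 0 h == 0) && sorted (fun a b => b <= a.+1) h.

Definition level (q : nat) (h : seq nat) : seq bool := [seq q < x | x <- h].

Definition levels_dvd (p : nat) (h : seq nat) : Prop :=
  forall q, runs_dvd p (level q h).

Definition glue (xy : seq nat * seq nat) : seq nat :=
  0 :: map succn xy.1 ++ xy.2.

(** The bound at the initial 0 forces [x] to start at 0; the step to the 0 heading [y] is always
    allowed. *)
Lemma heights_glue x y : head 0 y = 0 ->
  heights (glue (x, y)) = heights x && heights y.
Proof.
move=> y0; rewrite /heights /glue /= cat_path y0 eqxx /=; congr (_ && _).
  case: x => //= a x; rewrite ltnS leqn0 path_map; congr (_ && _).
by case: y y0 => //= a y ->.
Qed.

(** [y] begins at the first return to 0 and is empty if there is none. *)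
Lemma glue_surj t : exists x y, 0 :: t = glue (x, y) /\ head 0 y = 0.
Proof.
elim: t => [|[|a] t [x [y [[Et] y0]]]]; first by exists [::], [::].
  by exists [::], (0 :: t).
by exists (a :: x), y; rewrite Et.
Qed.

Lemma glue_inj xy xy' : head 0 xy.2 = 0 -> head 0 xy'.2 = 0 ->
  glue xy = glue xy' -> xy = xy'.
Proof.
case: xy xy' => [x y] [x' y'] /= y0 y'0 [].
elim: x x' => [|a x IH] [|a' x'] /= E; first by rewrite E.
- by move: y0; rewrite E.
- by move: y'0; rewrite -E.
- by case: E => -> /IH[-> ->].
Qed.

Lemma level0_glue x y : level 0 (glue (x, y)) = false :: nseq (size x) true ++ level 0 y.
Proof.
rewrite /level /glue /= map_cat -map_comp; congr (_ :: _ ++ _).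
by elim: x => //= a x ->.
Qed.

Lemma levelS_glue q x y : level q.+1 (glue (x, y)) = false :: level q x ++ level q.+1 y.
Proof. by rewrite /level /glue /= map_cat -map_comp. Qed.

Lemma head_level q h : head 0 h = 0 -> ~~ head false (level q h).
Proof. by case: h => //= a h ->. Qed.

(** Level 0 shows [x] as one run of length [size x], level [q.+1] shows level [q] of [x]; no run
    reaches into [y], which starts at 0. *)
Lemma levels_dvd_glue p x y : head 0 x = 0 -> head 0 y = 0 ->
  levels_dvd p (glue (x, y)) <-> [/\ p %| size x, levels_dvd p x & levels_dvd p y].
Proof.
move=> x0 y0; split=> [H|[px Hx Hy]].
  have Hy : levels_dvd p y.
    case=> [|q]; [have := H 0 | have := H q.+1]; rewrite ?level0_glue ?levelS_glue;
    by case/andP=> _ /runs_dvd_catr.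
  have py q : p %| count id (level q y) by rewrite runs_dvd_count ?head_level.
  split=> // [|q].
    have := H 0; rewrite level0_glue /= count_cat count_nseq mul1n => /andP[+ _].
    by rewrite dvdn_addl.
  by have := H q.+1; rewrite levelS_glue /= runs_dvd_cat // => /and3P[].
have py q : p %| count id (level q y) by rewrite runs_dvd_count ?head_level.
case=> [|q]; rewrite ?level0_glue ?levelS_glue /= runs_dvd_cat // count_cat.
  by rewrite count_nseq mul1n dvdn_add // runs_dvd_nseq Hy.
by rewrite dvdn_add ?Hx ?Hy // runs_dvd_count ?head_level.
Qed.

(** * Enumeration of height sequences *)

(* [n] is fuel: all sequences of length [s] are listed as soon as [s <= n]. *)
Fixpoint height_seqs (p n s : nat) : seq (seq nat) :=
  match n, s with
  | _, 0 => [:: [::]]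
  | 0, _ => [::]
  | n'.+1, s'.+1 =>
      [seq glue xy | m <- iota 0 (s' %/ p).+1,
         xy <- [seq (x, y) | x <- height_seqs p n' (m * p),
                             y <- height_seqs p n' (s' - m * p)]]
  end.

Lemma height_seqsSS p n s : height_seqs p n.+1 s.+1 =
  [seq glue xy | m <- iota 0 (s %/ p).+1,
     xy <- [seq (x, y) | x <- height_seqs p n (m * p),
                         y <- height_seqs p n (s - m * p)]].
Proof. by []. Qed.

Lemma mem_height_seqs p n s h : 0 < p -> s <= n ->
  h \in height_seqs p n s <-> [/\ size h = s, heights h & levels_dvd p h].
Proof.
move=> p0; elim: n s h => [|n IH] [|s] h //.
1,2: by rewrite /= inE; split=> [/eqP->|[/size0nil->]].
rewrite ltnS height_seqsSS => le_sn; split=> [/allpairsPdep[m [xy [m_s xy_in ->]]]|[szh hh Hh]].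
  move: m_s; rewrite mem_iota add0n ltnS => /andP[_ m_s].
  have le_mp : m * p <= s by rewrite (leq_trans (leq_mul m_s (leqnn p))) ?leq_divM.
  case/allpairsP: xy_in => -[x y] [/= x_in y_in ->].
  move: x_in y_in; rewrite !IH; try lia.
  move=> [szx hx Hx] [szy hy Hy].
  have [x0 _] := andP hx; have [y0 _] := andP hy.
  split; first by rewrite /= size_cat size_map szx szy subnKC.
    by rewrite heights_glue ?hx ?(eqP y0).
  by apply/levels_dvd_glue; rewrite ?(eqP x0) ?(eqP y0) ?szx ?dvdn_mull.
case: h szh hh Hh => [//|[|//] t] szt.
have [x [y [E y0]]] := glue_surj t; rewrite E heights_glue // => /andP[hx hy].
have [/eqP x0 _] := andP hx => /levels_dvd_glue[]// /dvdnP[m szx] Hx Hy.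
have [szxy] : (m * p + size y).+1 = s.+1.
  by rewrite -szt E /= size_cat size_map szx.
have m_s : m * p <= s by lia.
apply/allpairsPdep; exists m, (x, y); split=> //.
  by rewrite mem_iota /= add0n ltnS leq_divRL.
apply/allpairsP; exists (x, y); split=> //=; apply/IH; try lia.
  by split.
by rewrite -szxy addKn.
Qed.

Lemma height_seqs_uniq p n s : 0 < p -> s <= n -> uniq (height_seqs p n s).
Proof.
move=> p0; elim: n s => [|n IH] [|s] //; rewrite ltnS height_seqsSS => le_sn.
have le_mp m : m \in iota 0 (s %/ p).+1 -> m * p <= s.
  rewrite mem_iota add0n ltnS => /andP[_ m_s].
  by rewrite (leq_trans (leq_mul m_s (leqnn p))) ?leq_divM.
apply: allpairs_uniq_dep => [|m /le_mp le_m|]; first exact: iota_uniq.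
  apply: allpairs_uniq; [apply: IH; lia | apply: IH; lia |].
  by move=> [x y] [x' y'] _ _.
move=> [m xy] [m' xy'] /allpairsPdep[i [u [/le_mp le_i u_in [? ?]]]].
move=> /allpairsPdep[i' [u' [/le_mp le_i' u'_in [? ?]]]] /=; subst i i' u u'.
case/allpairsP: u_in => -[x y] [/= x_in y_in ?]; subst xy.
case/allpairsP: u'_in => -[x' y'] [/= x'_in y'_in ?]; subst xy'.
move: x_in y_in x'_in y'_in; rewrite !mem_height_seqs; try lia.
move=> [szx _ _] [_ /andP[/eqP y0 _] _] [szx' _ _] [_ /andP[/eqP y'0 _] _].
move/glue_inj=> /(_ y0 y'0) [? ?]; subst x' y'.
(* The summation index is determined by the length of [x]. *)
by move/eqP: szx'; rewrite szx eqn_pmul2r // => /eqP->.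
Qed.

(** * Raney numbers and the size of the enumeration *)

(* Coefficient of z^k in T^r, where T = 1 + z T^q. *)
Fixpoint raney_nat (q k r : nat) : nat :=
  if k is k'.+1 then \sum_(i < r) raney_nat q k' (i + q) else 1.

Lemma raney_natSS q k r :
  raney_nat q k.+1 r.+1 = raney_nat q k.+1 r + raney_nat q k (r + q).
Proof. exact: big_ord_recr. Qed.

(** Coefficients in [T^a * T^b = T^(a + b)]; the induction uses [T^(r + 1) = T^r + z T^(r + q)]. *)
Lemma raney_nat_conv q k a b :
  \sum_(i < k.+1) raney_nat q i a * raney_nat q (k - i) b = raney_nat q k (a + b).
Proof.
elim: k a b => [|k IHk] a b; first by rewrite big_ord_recl big_ord0.
elim: a => [|a IHa].
  rewrite big_ord_recl big1 => [|i _]; first by rewrite mul1n addn0.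
  by rewrite /= big_ord0.
rewrite addSn raney_natSS -IHa -[a + b + q]addnAC -IHk.
rewrite big_ord_recl [X in _ = X + _]big_ord_recl -addnA; congr (_ + _).
rewrite -big_split; apply: eq_bigr => i _.
by rewrite !lift0 raney_natSS mulnDl subSS.
Qed.

Lemma raney_nat_bin q k r : 0 < q ->
  (k * q + r) * raney_nat q k r = r * 'C(k * q + r, k).
Proof.
move=> q0; elim: k r => [|k IHk] r; first by rewrite mul0n add0n bin0.
elim: r => [|r IHr]; first by rewrite /= big_ord0 muln0.
(* Both induction hypotheses have [N] on top of the binomial; Pascal's rule and [binE] leave a
   polynomial identity. *)
rewrite raney_natSS addnS; set N := k.+1 * q + r in IHr *.
have IHk' := IHk (r + q); rewrite (_ : k * q + (r + q) = N) in IHk'; last by lia.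
have N0 : 0 < N by rewrite /N mulSn; lia.
have binE : k.+1 * 'C(N, k.+1) = (N - k) * 'C(N, k) by rewrite mul_bin_left.
have le_kN : k <= N by rewrite /N; nia.
apply/eqP; rewrite -(eqn_pmul2l N0) mulnCA mulnDr IHr IHk' binS; apply/eqP.
have [M NE] : exists M, N = k + M by exists (N - k); rewrite subnKC.
have NE' : N = k.+1 * q + r by [].
rewrite NE addKn in binE; move: binE NE' {IHr IHk IHk'}; rewrite NE.
move: 'C(_, _) 'C(_, _) => A B; clear; nia.
Qed.

Lemma size_height_seqs p n s : 0 < p -> s <= n ->
  size (height_seqs p n s) = raney_nat p.+1 (s %/ p) (s %% p).+1.
Proof.
move=> p0; elim: n s => [|n IH] [|s] //; try by rewrite div0n.
rewrite ltnS => le_sn; rewrite height_seqsSS size_allpairs_dep sumnE big_map.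
rewrite -[(s %/ p).+1]subn0 -/(index_iota _ _) big_mkord.
transitivity (\sum_(m < (s %/ p).+1)
   raney_nat p.+1 m 1 * raney_nat p.+1 (s %/ p - m) (s %% p).+1).
  apply: eq_bigr => m _; rewrite size_allpairs.
  have le_mp : m * p <= s.
    by rewrite (leq_trans (leq_mul (ltnSE (ltn_ord m)) (leqnn p))) ?leq_divM.
  rewrite !IH; try lia.
  rewrite mulnK // modnMl; congr (_ * raney_nat _ _ _.+1).
    by rewrite divnBMl.
  by rewrite -[in RHS](subnKC le_mp) modnMDl.
rewrite raney_nat_conv add1n.
have lt_r := ltn_pmod s p0.
(* If [p] divides [s.+1], the quotient goes up and the exponent [p.+1] becomes 1, by
   [T = 1 + z T^(p + 1)]; otherwise only the remainder goes up. *)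
have [E|ne] := eqVneq (s %% p).+1 p.
  rewrite (_ : s.+1 = (s %/ p).+1 * p); last by rewrite {1}(divn_eq s p) mulSn; lia.
  by rewrite mulnK // modnMl raney_natSS /= big_ord0 add0n E.
have E : s.+1 = s %/ p * p + (s %% p).+1 by rewrite {1}(divn_eq s p) addnS.
have lt_r1 : (s %% p).+1 < p by rewrite ltn_neqAle ne.
by rewrite E divnMDl // (divn_small lt_r1) addn0 modnMDl (modn_small lt_r1).
Qed.

(** * Height sequences and simultaneous cores *)

(* Position [q * size h + c] carries [q < nth 0 h c]. *)
Definition word_of_heights (h : seq nat) : seq bool :=
  flatten [seq level q h | q <- iota 0 (size h)].

Lemma nth_heights_le h c : heights h -> nth 0 h c <= c.
Proof.
case/andP=> h0 /(sortedP 0) hS; elim: c => [|c IH]; first by rewrite nth0 leqn0.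
case: (ltnP c.+1 (size h)) => [/hS|/(nth_default 0)->//].
by move/leq_trans; apply.
Qed.

Lemma size_word_of_heights h : size (word_of_heights h) = size h * size h.
Proof.
rewrite /word_of_heights -[X in _ = X * _](size_iota 0).
by elim: (iota _ _) => //= q r IH; rewrite size_cat IH size_map.
Qed.

(** Stopping after [size h] levels loses nothing, since [nth 0 h c <= c]. *)
Lemma nth_word_of_heights h i : heights h ->
  nth false (word_of_heights h) i = (i %/ size h < nth 0 h (i %% size h)).
Proof.
move=> hh; have [h0|h0] := posnP (size h).
  by rewrite (size0nil h0) nth_nil nth_nil.
have [lt_i|le_i] := ltnP i (size h * size h); last first.
  rewrite nth_default ?size_word_of_heights //; apply/esym/negbTE.
  rewrite -leqNgt (leq_trans (nth_heights_le _ hh)) //.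
  by rewrite (leq_trans (ltnW (ltn_pmod i h0))) // leq_divRL.
suff H k a j : j < k * size h ->
    nth false (flatten [seq level q h | q <- iota a k]) j =
    (a + j %/ size h < nth 0 h (j %% size h)) by rewrite H.
elim: k a j => [|k IH] a j //=; rewrite mulSn nth_cat size_map => lt_j.
case: ltnP => [lt_jh|le_hj]; first by rewrite (nth_map 0) // divn_small // modn_small // addn0.
rewrite IH; last by lia.
rewrite -[in RHS](subnK le_hj) modnDr divnDr // divnn h0 addSn addnA addn1.
by [].
Qed.

(** No level starts with [true], so no run crosses between levels; the levels beyond the word are
    constantly [false]. *)
Lemma all_dvd_word_of_heights p h : heights h ->
  all (fun x => p %| x) (parts_of (word_of_heights h)) <-> levels_dvd p h.
Proof.
move=> hh; have /andP[/eqP h0 _] := hh; rewrite all_dvd_parts_of.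
have hd r : ~~ head false (flatten [seq level q h | q <- r]).
  by elim: r => //= a r IHr; case: (h) h0 IHr => //= b u ->.
have cat_ok r : runs_dvd p (flatten [seq level q h | q <- r]) <->
    (forall q, q \in r -> runs_dvd p (level q h)).
  elim: r => //= q r IH; split=> [H|H].
    have /IH Hr := runs_dvd_catr H.
    have cnt : p %| count id (flatten [seq level q h | q <- r]).
      by apply: runs_dvd_count => //; exact/IH.
    by move: H; rewrite runs_dvd_cat // => /andP[Hq _] a; rewrite inE => /orP[/eqP->|/Hr].
  have Hr : runs_dvd p (flatten [seq level q h | q <- r]).
    by apply/IH => a a_r; apply: H; rewrite inE a_r orbT.
  rewrite runs_dvd_cat; first by rewrite Hr H ?mem_head.
  exact: runs_dvd_count.
rewrite /word_of_heights cat_ok; split=> H q; last by [].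
have [lt_q|le_q] := ltnP q (size h); first by apply: H; rewrite mem_iota.
suff -> : level q h = nseq (size h) false by exact: runs_dvd_nseq.
apply: (@eq_from_nth _ false); rewrite size_map ?size_nseq // => i lt_i.
rewrite (nth_map 0) // nth_nseq lt_i; apply/negbTE; rewrite -leqNgt.
by rewrite (leq_trans (nth_heights_le _ hh)) // (leq_trans (ltnW lt_i)).
Qed.

Lemma is_core_word_of_heights h : 0 < size h -> heights h ->
  is_core (size h) (parts_of (word_of_heights h)) &&
  is_core (size h).+1 (parts_of (word_of_heights h)).
Proof.
move=> h0 hh; apply/andP; split; apply/is_core_parts_ofE => // b;
  rewrite !nth_word_of_heights //.
  by rewrite modnDr divnDr // divnn h0 addn1 => /ltnW.
have /andP[/eqP hh0 /(sortedP 0) hS] := hh.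
rewrite addnS -addSn modnDr divnDr // divnn h0 addn1.
have lt_r := ltn_pmod b h0.
rewrite {1 2}(divn_eq b (size h)) -addnS.
(* For [b] in the last column, [b + (size h).+1] falls in column 0, of height 0, so the premise
   fails. *)
have [E|ne] := eqVneq (b %% size h).+1 (size h).
  by rewrite E modnDr modnMl nth0 hh0.
have lt_r' : (b %% size h).+1 < size h by lia.
rewrite divnMDl // modnMDl (divn_small lt_r') (modn_small lt_r') addn0.
by move/leq_trans=> /(_ _ (hS _ lt_r')).
Qed.

(** The words have length [s * s] and start with [false], so the first part counts their [true]s and
    [parts_of_inj] applies. *)
Lemma word_of_heights_inj s : 0 < s ->
  {in [pred h | (size h == s) && heights h] &, injective (parts_of \o word_of_heights)}.
Proof.
move=> s0 h h'; rewrite !inE => /andP[/eqP sh hh] /andP[/eqP sh' hh'] /= E.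
have szE : size (word_of_heights h) = size (word_of_heights h').
  by rewrite !size_word_of_heights sh sh'.
have hd u : size u = s -> heights u -> exists w, word_of_heights u = false :: w.
  move=> su hu; case Ew: (word_of_heights u) => [|b w].
    by have := size_word_of_heights u; rewrite Ew su /=; nia.
  exists w; congr (_ :: _); have := nth_word_of_heights 0 hu; rewrite Ew /= => ->.
  by rewrite mod0n nth0; case/andP: hu => /eqP->; rewrite ltn0.
have row0 w : head 0 (parts_of (false :: w)) = count id w.
  rewrite /=; case: eqP => //= w0; rewrite w0.
  by case: (parts_of w) (parts_of_le w) => //= a l; rewrite w0 leqn0 => /andP[/eqP].
have wE : word_of_heights h = word_of_heights h'.
  apply: parts_of_inj => //; move: E.
  have [w ->] := hd h sh hh; have [w' ->] := hd h' sh' hh' => /(congr1 (head 0)).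
  by rewrite !row0 /= => ->.
apply: (@eq_from_nth _ 0) => [|c]; first by rewrite sh.
rewrite sh => lt_c.
have lt_iff q : (q < nth 0 h c) = (q < nth 0 h' c).
  have := congr1 (fun w => nth false w (q * s + c)) wE.
  by rewrite !nth_word_of_heights // sh sh' divnMDl // modnMDl divn_small // modn_small // addn0.
have [||//] := ltngtP (nth 0 h c) (nth 0 h' c); first by rewrite -lt_iff ltnn.
by rewrite lt_iff ltnn.
Qed.

Lemma ltn_count_iota (a : pred nat) N q : (forall i, a i.+1 -> a i) ->
  q < N -> (q < count a (iota 0 N)) = a q.
Proof.
elim: N a q => [//|N IH] a q aS lt_q.
rewrite /= -[1]addn0 iotaDl count_map.
have [a0|aN0] := boolP (a 0).
  by case: q lt_q => [|q] lt_q; rewrite ?a0 // add1n ltnS IH // => i; exact: aS.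
have aN i : a i = false by apply/negbTE; elim: i => // i; apply: contra => /aS.
by rewrite aN (eq_count (a2 := pred0)) ?count_pred0 // => i /=; rewrite aN.
Qed.

Lemma heights_of_core s w : 0 < s -> ~~ nth false w 0 ->
  is_core s (parts_of w) -> is_core s.+1 (parts_of w) ->
  exists h, [/\ size h = s, heights h & parts_of (word_of_heights h) = parts_of w].
Proof.
move=> s0 w0 /(is_core_parts_ofE _ s0) cs /is_core_parts_ofE - /(_ isT) cs1.
(* [size w] levels suffice: later positions read [false] by default. *)
pose f c := count (fun q => nth false w (q * s + c)) (iota 0 (size w)).
have fE q c : (q < f c) = nth false w (q * s + c).
  have [lt_q|le_q] := ltnP q (size w).
    by apply: ltn_count_iota => // i; rewrite mulSn addnC addnA addnAC => /cs; rewrite addnC.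
  rewrite nth_default; last by rewrite (leq_trans le_q) // (leq_trans (leq_pmulr q s0)) ?leq_addr.
  apply/negbTE; rewrite -leqNgt (leq_trans _ le_q) // -[X in _ <= X](size_iota 0).
  exact: count_size.
pose h := mkseq f s; have szh : size h = s by rewrite size_mkseq.
have hh : heights h.
  apply/andP; split; first by rewrite -nth0 nth_mkseq // eqn0Ngt fE.
  apply/(sortedP 0) => i; rewrite szh => lt_i.
  (* A larger ascent would make level [(f i).+1] of column [i.+1] true; subtracting [s.+1] would
     reach level [f i] of column [i]. *)
  rewrite (nth_mkseq _ _ lt_i) (nth_mkseq _ _ (ltnW lt_i)) leqNgt fE mulSn.
  apply/negP; rewrite (_ : _ + _ = f i * s + i + s.+1); last by lia.
  by move/cs1; rewrite -fE ltnn.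
exists h; split=> //; apply: parts_of_eq_nth => i.
by rewrite nth_word_of_heights // szh nth_mkseq ?ltn_pmod // fE -divn_eq.
Qed.

(** * Closed forms and the final count *)

Lemma raney_natE q k r : 0 < q ->
  ((raney_nat q k r.+1)%:R)%R = raney q r.+1 k :> rat.
Proof.
move=> q0; have := raney_nat_bin k r.+1 q0; rewrite /raney => /(congr1 (fun n => n%:R : rat)%R).
have nz : ((k * q + r.+1)%:R != 0 :> rat)%R by rewrite pnatr_eq0 addnS.
by rewrite !natrM mulrAC => <-; rewrite mulrAC divff // mul1r.
Qed.

Lemma raney_div (s p : nat) : 0 < p ->
  raney p.+1 (s %% p).+1 (s %/ p) =
  ((s.+1 - p * (s %/ p))%:R / (s.+1)%:R * ('C(s + s %/ p, s))%:R)%R.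
Proof.
move=> p0; rewrite /raney.
have sE := divn_eq s p.
have -> : s %/ p * p.+1 + (s %% p).+1 = (s + s %/ p).+1.
  by rewrite mulnS addnS -addnA -sE addnC.
have -> : s.+1 - p * (s %/ p) = (s %% p).+1.
  by rewrite {1}sE mulnC -addnS addKn.
rewrite -!mulrA; congr (_ * _)%R.
(* Absorption identity, after passing to the complementary lower index. *)
have bE : s.+1 * 'C((s + s %/ p).+1, s %/ p) = (s + s %/ p).+1 * 'C(s + s %/ p, s).
  have := mul_bin_diag (s + s %/ p).+1 s; rewrite /= => ->.
  rewrite -bin_sub; last by rewrite ltnW // ltnS leq_addl.
  by congr (_ * 'C(_, _)); lia.
have nz1 : ((s.+1)%:R != 0 :> rat)%R by rewrite pnatr_eq0.
have nz2 : (((s + s %/ p).+1)%:R != 0 :> rat)%R by rewrite pnatr_eq0.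
move: bE => /(congr1 (fun n => n%:R : rat)%R); rewrite !natrM => bE.
apply: (mulfI nz1); apply: (mulfI nz2); rewrite (mulVKf nz1).
by rewrite mulrCA (mulVKf nz2).
Qed.

Theorem theorem3p1 (s p : nat) (hs : 0 < s) (hp : 0 < p) :
  exists l : seq (seq nat),
    [/\ uniq l,
        (forall la : seq nat,
            la \in l =
            [&& is_partition la, is_core s la, is_core s.+1 la
              & all (fun x => p %| x) la]),
        ((size l)%:R)%R = raney p.+1 (s %% p).+1 (s %/ p) :> rat
      & ((size l)%:R)%R =
          ((s.+1 - p * (s %/ p))%:R / (s.+1)%:R * ('C(s + s %/ p, s))%:R)%R :> rat].
Proof.
exists (map (parts_of \o word_of_heights) (height_seqs p s s)).
rewrite size_map size_height_seqs // raney_natE // -raney_div //; split=> // [|la].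
  rewrite map_inj_in_uniq ?height_seqs_uniq // => h h'.
  rewrite !mem_height_seqs // => -[sh hh _] [sh' hh' _].
  by apply: (word_of_heights_inj hs); rewrite inE ?sh ?sh' ?hh ?hh' eqxx.
apply/mapP/idP => [[h /(mem_height_seqs _ hp (leqnn s))[sh hh Hh] ->]|].
  rewrite /= parts_of_partition (iffRL (all_dvd_word_of_heights p hh)) //.
  by have := is_core_word_of_heights _ hh; rewrite sh => /(_ hs)/andP[-> ->].
case/and4P=> la_part cs cs1 la_p.
(* Position 0 gives column 0 its height 0; the empty partition is covered by the default [false]. *)
have w0 : ~~ nth false (word_of la) 0 by case: (la).
rewrite -(word_ofK la_part) in cs cs1 la_p *.
have [h [sh hh E]] := heights_of_core hs w0 cs cs1.
exists h; last by rewrite /= E.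
apply/mem_height_seqs => //; split=> //.
by apply/(all_dvd_word_of_heights _ hh); rewrite E.
Qed.
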